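(* Let $B\subset A$ be a non-degenerate inclusion of $C^*$-algebras which is regular. Then the following conditions are equivalent: (i) $A$ is simple; (ii) the inclusion $B\subset A$ is essential and minimal.
   Context: Ideals are closed and two-sided; a $C^*$-algebra is simple if it has no ideals other than $\{0\}$ and itself. An inclusion of $C^*$-algebras $B\subset A$ is non-degenerate if $B$ contains an approximate unit for $A$; in this case there is a canonical unital inclusion of multiplier algebras $M(B)\subset M(A)$. For a $C^*$-inclusion $B\subset A$, the set of normalizers is $\mathcal{N}_A(B)=\{n\in A: nBn^*\cup n^*Bn\subset B\}$. The same definition is used for $C^*$-subalgebras of $M(A)$: e.g. $\mathcal{N}_{M(A)}(B)=\{n\in M(A): nBn^*\cup n^*Bn\subset B\}$, and, for an ideal $J$ of $B$, $\mathcal{N}_{M(A)}(J)=\{n\in M(A): nJn^*\cup n^*Jn\subset J\}$. The non-degenerate inclusion $B\subset A$ is regular if $\mathcal{N}_A(B)$ generates $A$ as a $C^*$-algebra. It is essential if the only proper ideal $L$ of $A$ with $B\cap L=\{0\}$ is $L=\{0\}$. An ideal $J$ of $B$ is fully normalized in $A$, relative to $B$, if $\mathcal{N}_{M(A)}(B)\subset\mathcal{N}_{M(A)}(J)$. The inclusion $B\subset A$ is minimal if the only ideals $J$ of $B$ that are fully normalized in $A$ relative to $B$ are $J=\{0\}$ and $J=B$. *)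

(* Defs.v *)
From HB Require Import structures.
From mathcomp Require Import all_boot all_order all_algebra.
From mathcomp Require Import all_classical all_reals all_analysis.
From mathcomp Require Export complex.
Set Implicit Arguments.
Unset Strict Implicit.
Unset Printing Implicit Defensive.
Import Order.TTheory GRing.Theory Num.Theory.
Import numFieldNormedType.Exports.
Local Open Scope classical_set_scope.
Local Open Scope ring_scope.
Local Open Scope complex_scope.

(* Complex C*-algebras. They are not assumed to be unital, hence they are not
   instances of the ring structures of MathComp. *)
HB.mixin Record isCStarAlgebra (R : realType) A
    of CompleteNormedModule R[i] A := {
  cmul : A -> A -> A ;
  cstar : A -> A ;
  cmulA : associative cmul ;
  cmulDl : left_distributive cmul +%R ;
  cmulDr : right_distributive cmul +%R ;
  cmulZl : forall (k : R[i]) (a b : A), cmul (k *: a) b = k *: cmul a b ;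
  cmulZr : forall (k : R[i]) (a b : A), cmul a (k *: b) = k *: cmul a b ;
  cstarK : involutive cstar ;
  cstarD : {morph cstar : a b / a + b} ;
  cstarZ : forall (k : R[i]) (a : A), cstar (k *: a) = k^* *: cstar a ;
  cstarM : forall a b : A, cstar (cmul a b) = cmul (cstar b) (cstar a) ;
  cnormM : forall a b : A, `|cmul a b| <= `|a| * `|b| ;
  cnorm_star : forall a : A, `|cmul (cstar a) a| = `|a| ^+ 2
}.

#[short(type="cstarAlgType")]
HB.structure Definition CStarAlgebra (R : realType) :=
  { A of isCStarAlgebra R A & CompleteNormedModule R[i] A }.

Declare Scope cstar_scope.
Delimit Scope cstar_scope with cstar.
Notation "a ** b" := (cmul a b) (at level 40, left associativity) : cstar_scope.
Local Open Scope cstar_scope.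

(* [T] is either a C*-algebra or its multiplier algebra. *)
Definition normalizer (T : Type) (mul : T -> T -> T) (star : T -> T)
    (B : set T) : set T :=
  [set n | forall b, B b ->
             B (mul (mul n b) (star n)) /\ B (mul (mul (star n) b) n)].

Section CStarAlgebras.
Context (R : realType) (A : cstarAlgType R).
Implicit Types (B J L : set A) (a b : A).

Definition linear_subspace (V : set A) : Prop :=
  [/\ V 0, forall a b, V a -> V b -> V (a + b)
    & forall (k : R[i]) a, V a -> V (k *: a)].

Definition cstar_subalgebra B : Prop :=
  [/\ linear_subspace B, closed B,
      forall a b, B a -> B b -> B (a ** b)
    & forall a, B a -> B (cstar a)].

(* [J] is a closed two-sided ideal of the C*-subalgebra [B]; the ideals of the
   whole algebra are the case [B = setT]. *)
Definition cstar_ideal B J : Prop :=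
  [/\ J `<=` B, linear_subspace J, closed J
    & forall a b, J a -> B b -> J (a ** b) /\ J (b ** a)].

Definition cstar_simple : Prop :=
  forall L, cstar_ideal setT L -> L = [set 0] \/ L = setT.

Definition cstar_positive a : Prop := exists b, a = cstar b ** b.

Definition directed (I : Type) (le : I -> I -> Prop) : Prop :=
  [/\ (exists i : I, True), forall i, le i i,
      forall i j k, le i j -> le j k -> le i k
    & forall i j, exists k, le i k /\ le j k].

Definition tails (I : Type) (le : I -> I -> Prop) : set_system I :=
  filter_from setT (fun i => [set j | le i j]).

Definition approximate_unit (I : Type) (le : I -> I -> Prop) (e : I -> A) :
    Prop :=
  [/\ directed le,
      forall i, cstar_positive (e i) /\ `|e i| <= 1
    & forall a, e i ** a @[i --> tails le] --> a /\
                a ** e i @[i --> tails le] --> a].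

Definition nondegenerate_inclusion B : Prop :=
  exists (I : Type) (le : I -> I -> Prop) (e : I -> A),
    approximate_unit le e /\ forall i, B (e i).

Definition regular_inclusion B : Prop :=
  smallest cstar_subalgebra
    (normalizer (@cmul R A) (@cstar R A) B) = setT.

Definition essential_inclusion B : Prop :=
  forall L, cstar_ideal setT L -> L <> setT -> B `&` L = [set 0] -> L = [set 0].

(* The multiplier algebra M(A), realized by double centralizers: the multiplier
   [m] acts on [A] by [m a = lmult m a] and [a m = rmult m a]. *)

Definition bounded_operator (f : A -> A) : Prop :=
  [/\ forall a b, f (a + b) = f a + f b,
      forall (k : R[i]) a, f (k *: a) = k *: f a
    & exists k : R, forall a, `|f a| <= k%:C * `|a|].

Record multiplier : Type := Multiplier {
  lmult : A -> A ;
  rmult : A -> A ;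
  lmult_bounded : bounded_operator lmult ;
  rmult_bounded : bounded_operator rmult ;
  lmultM : forall a b, lmult (a ** b) = lmult a ** b ;
  rmultM : forall a b, rmult (a ** b) = a ** rmult b ;
  rlmult : forall a b, rmult a ** b = a ** lmult b
}.

Lemma multiplier_ext (m n : multiplier) :
  lmult m =1 lmult n -> rmult m =1 rmult n -> m = n.
Proof.
case: m n => [f g p1 p2 p3 p4 p5] [f' g' q1 q2 q3 q4 q5] /= /funext ff' /funext gg'.
subst f' g'; congr Multiplier; exact: Prop_irrelevance.
Qed.

Lemma bounded_operator_comp (f g : A -> A) :
  bounded_operator f -> bounded_operator g -> bounded_operator (f \o g).
Proof.
case=> fD fZ [kf Hf] [gD gZ [kg Hg]]; split=> [a b|k a|] /=.
- by rewrite gD fD.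
- by rewrite gZ fZ.
exists (`|kf| * kg) => a; apply: le_trans (Hf (g a)) _.
apply: (@le_trans _ _ (`|kf|%:C * `|g a|)).
  by rewrite ler_wpM2r// lecR ler_norm.
by rewrite rmorphM -mulrA ler_wpM2l// lecR.
Qed.

Lemma cnorm_cstar a : `|cstar a| = `|a|.
Proof.
have H c : `|c| <= `|cstar c|.
  have [->|c0] := eqVneq c 0; first by rewrite normr0.
  have cp : 0 < `|c| by rewrite normr_gt0.
  by rewrite -(ler_pM2r cp) -expr2 -cnorm_star cnormM.
by apply/eqP; rewrite eq_le H andbT -{2}(cstarK a) H.
Qed.

Lemma bounded_operator_star (f : A -> A) :
  bounded_operator f -> bounded_operator (fun a => cstar (f (cstar a))).
Proof.
case=> fD fZ [kf Hf]; split=> [a b|k a|].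
- by rewrite cstarD fD cstarD.
- by rewrite cstarZ fZ cstarZ conjCK.
by exists kf => a; rewrite cnorm_cstar -(cnorm_cstar a).
Qed.

Program Definition mmul (m n : multiplier) : multiplier :=
  @Multiplier (lmult m \o lmult n) (rmult n \o rmult m) _ _ _ _ _.
Next Obligation.
by move=> m n; apply: bounded_operator_comp; apply: lmult_bounded.
Qed.
Next Obligation.
by move=> m n; apply: bounded_operator_comp; apply: rmult_bounded.
Qed.
Next Obligation. by move=> m n a b /=; rewrite !lmultM. Qed.
Next Obligation. by move=> m n a b /=; rewrite !rmultM. Qed.
Next Obligation. by move=> m n a b /=; rewrite !rlmult. Qed.

Program Definition mstar (m : multiplier) : multiplier :=
  @Multiplier (fun a => cstar (rmult m (cstar a)))
              (fun a => cstar (lmult m (cstar a))) _ _ _ _ _.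
Next Obligation.
by move=> m; apply: bounded_operator_star; apply: rmult_bounded.
Qed.
Next Obligation.
by move=> m; apply: bounded_operator_star; apply: lmult_bounded.
Qed.
Next Obligation. by move=> m a b /=; rewrite cstarM rmultM cstarM cstarK. Qed.
Next Obligation. by move=> m a b /=; rewrite cstarM lmultM cstarM cstarK. Qed.
Next Obligation.
by move=> m a b /=; rewrite -{1}(cstarK b) -cstarM -rlmult cstarM cstarK.
Qed.

Program Definition embed (c : A) : multiplier :=
  @Multiplier (fun a => c ** a) (fun a => a ** c) _ _ _ _ _.
Next Obligation.
move=> c; split=> [a b|k a|]; [exact: cmulDr|exact: cmulZr|].
exists (complex.Re `|c|) => a; rewrite RRe_real ?normr_real//; exact: cnormM.
Qed.
Next Obligation.
move=> c; split=> [a b|k a|]; [exact: cmulDl|exact: cmulZl|].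
exists (complex.Re `|c|) => a; rewrite RRe_real ?normr_real// mulrC; exact: cnormM.
Qed.
Next Obligation. by move=> c a b /=; rewrite cmulA. Qed.
Next Obligation. by move=> c a b /=; rewrite cmulA. Qed.
Next Obligation. by move=> c a b /=; rewrite cmulA. Qed.

Lemma mmulA : associative mmul.
Proof. by move=> m n p; apply: multiplier_ext. Qed.

Lemma mstarK : involutive mstar.
Proof. by move=> m; apply: multiplier_ext => a /=; rewrite !cstarK. Qed.

Lemma mstarM m n : mstar (mmul m n) = mmul (mstar n) (mstar m).
Proof. by apply: multiplier_ext => a /=; rewrite !cstarK. Qed.

Lemma embedM a b : embed (a ** b) = mmul (embed a) (embed b).
Proof. by apply: multiplier_ext => c /=; rewrite cmulA. Qed.

Lemma embed_star a : embed (cstar a) = mstar (embed a).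
Proof. by apply: multiplier_ext => c /=; rewrite cstarM cstarK. Qed.

Lemma mmul_embed m a : mmul m (embed a) = embed (lmult m a).
Proof. by apply: multiplier_ext => b /=; rewrite ?lmultM ?rlmult. Qed.

Lemma embed_inj : injective embed.
Proof.
move=> a b /(congr1 lmult)/(congr1 (fun f => f (cstar (a - b)))) /= ab.
have c0 : (a - b) ** cstar (a - b) = 0.
  by rewrite cmulDl ab -cmulDl subrr -[X in X ** _](scale0r 0) cmulZl scale0r.
apply/eqP; rewrite -subr_eq0 -normr_eq0 -cnorm_cstar -sqrf_eq0 -cnorm_star.
by rewrite cstarK c0 normr0.
Qed.

Definition fully_normalized B J : Prop :=
  normalizer mmul mstar (embed @` B) `<=` normalizer mmul mstar (embed @` J).

Definition minimal_inclusion B : Prop :=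
  forall J, cstar_ideal B J -> fully_normalized B J -> J = [set 0] \/ J = B.

End CStarAlgebras.

Arguments cstar_simple {R} A.

(* Main.v *)
(* If [A] is simple and [J] is a nonzero fully normalized ideal of [B], the closed
   right ideal [K] of [A] generated by [J] is invariant under left multiplication
   by normalizers, because [n J n^* <= J]; by regularity it is a two-sided ideal,
   hence all of [A], and [J] contains [B] since [B] meets [K] in [J]. Conversely,
   for an ideal [L] of [A] the ideal [B] meet [L] of [B] is fully normalized, so it
   is [0], and then [L] is [0] or [A] by essentiality, or it is [B], and then
   [L = A] because [B] contains an approximate unit of [A].

   The C*-algebraic input is that [x] is a limit of elements [u x] with [u] in the
   closed ideal generated by [h = x x^*] and [1 - u] contractive. Take
   [u = h^2 (t^2 + h^2)^-1] with [t] small. No positivity of [x x^*] and no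
   functional calculus are needed: for self-adjoint [h] the C*-identity gives
   [|1 + i s h| <= 1 + s^2 |h|^2 / 2], from which [h + i t] is invertible with
   inverse of norm at most [1 / |t|], as in the Hille-Yosida theorem. *)

Require Import Defs.
From mathcomp Require Import all_boot all_order all_algebra.
From mathcomp Require Import all_classical all_reals all_analysis.
From mathcomp Require Import ring lra.
Import Order.TTheory GRing.Theory Num.Theory.
Import numFieldNormedType.Exports.
Local Open Scope classical_set_scope.
Local Open Scope ring_scope.
Local Open Scope complex_scope.
Local Open Scope cstar_scope.

(** * Real-valued norm estimates and the contraction principle *)

Section CStarNorm.
Context {R : realType} {A : cstarAlgType R}.
Implicit Types (a b c x y : A) (V : set A) (r : R) (k : R[i]).

Lemma cmulNl a b : (- a) ** b = - (a ** b).
Proof. by rewrite -scaleN1r cmulZl scaleN1r. Qed.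

Lemma cmulNr a b : a ** (- b) = - (a ** b).
Proof. by rewrite -scaleN1r cmulZr scaleN1r. Qed.

Lemma cmulBl a b c : (a - b) ** c = a ** c - b ** c.
Proof. by rewrite cmulDl cmulNl. Qed.

Lemma cmulBr a b c : a ** (b - c) = a ** b - a ** c.
Proof. by rewrite cmulDr cmulNr. Qed.

Lemma cstarN a : cstar (- a) = - cstar a.
Proof. by rewrite -scaleN1r cstarZ rmorphN rmorph1 scaleN1r. Qed.

Lemma cstarB a b : cstar (a - b) = cstar a - cstar b.
Proof. by rewrite cstarD cstarN. Qed.

(* The norm of [A] takes its values in [R[i]]; [rnorm] is the same norm with
   values in [R]. *)
Definition rnorm a : R := complex.Re `|a|.

Lemma rnormE a : `|a| = (rnorm a)%:C.
Proof. by rewrite /rnorm RRe_real ?normr_real. Qed.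

Lemma rnorm_ge0 a : 0 <= rnorm a.
Proof. by rewrite -lecR -rnormE normr_ge0. Qed.

Lemma rnorm0 : rnorm 0 = 0.
Proof. by rewrite /rnorm normr0. Qed.

Lemma rnormD a b : rnorm (a + b) <= rnorm a + rnorm b.
Proof. by rewrite -lecR rmorphD/= -!rnormE ler_normD. Qed.

Lemma rnormN a : rnorm (- a) = rnorm a.
Proof. by rewrite /rnorm normrN. Qed.

Lemma rnormB a b : rnorm (a - b) <= rnorm a + rnorm b.
Proof. by rewrite -(rnormN b) rnormD. Qed.

Lemma rnormBC a b : rnorm (a - b) = rnorm (b - a).
Proof. by rewrite -rnormN opprB. Qed.

Lemma rnormZ k a : rnorm (k *: a) = complex.Re `|k| * rnorm a.
Proof.
by apply: (@complexI R); rewrite -rnormE normrZ rmorphM/= -rnormE.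
Qed.

Lemma rnormZR r a : rnorm (r%:C *: a) = `|r| * rnorm a.
Proof. by rewrite rnormZ normc_def /= expr0n addr0 sqrtr_sqr. Qed.

Lemma rnormZi r a : rnorm (('i * r%:C) *: a) = `|r| * rnorm a.
Proof.
rewrite -scalerA rnormZ normc_def /= expr0n add0r expr1n sqrtr1 mul1r.
exact: rnormZR.
Qed.

Lemma rnormM a b : rnorm (a ** b) <= rnorm a * rnorm b.
Proof. by rewrite -lecR rmorphM/= -!rnormE cnormM. Qed.

Lemma rnorm_cstar a : rnorm (cstar a) = rnorm a.
Proof. by rewrite /rnorm cnorm_cstar. Qed.

Lemma rnorm_cstarM a : rnorm (cstar a ** a) = rnorm a ^+ 2.
Proof.
by apply: (@complexI R); rewrite -rnormE cnorm_star rnormE rmorphXn.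
Qed.

Lemma rnormM_cstar a : rnorm (a ** cstar a) = rnorm a ^+ 2.
Proof. by rewrite -{1}(cstarK a) rnorm_cstarM rnorm_cstar. Qed.

Lemma rnorm_eq0 a : rnorm a <= 0 -> a = 0.
Proof.
move=> a0; apply/eqP; rewrite -normr_eq0 rnormE.
by have -> : rnorm a = 0 by apply/eqP; rewrite eq_le a0 rnorm_ge0.
Qed.

Lemma closed_rnorm V a : closed V ->
  (forall e : R, 0 < e -> exists2 v, V v & rnorm (a - v) < e) -> V a.
Proof.
move=> Vcl H; apply: Vcl => U /nbhs_ballP[e e0 eU].
have ee : e = (complex.Re e)%:C by rewrite RRe_real ?gtr0_real.
have [|v Vv av] := H (complex.Re e); first by rewrite -ltcR -ee.
exists v; split=> //; apply: eU; rewrite -ball_normE /=.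
by rewrite rnormE ee ltcR.
Qed.

Lemma closure_rnorm V a : closure V a ->
  forall e : R, 0 < e -> exists2 v, V v & rnorm (a - v) < e.
Proof.
move=> Va e e0; have [|v [Vv]] := Va (ball a e%:C).
  by apply: nbhsx_ballx; rewrite ltcR.
by rewrite -ball_normE /= rnormE ltcR => av; exists v.
Qed.

Lemma rnorm_cauchy_cvg (u : nat -> A) :
  (forall e : R, 0 < e -> exists N, forall n, (N <= n)%N ->
     rnorm (u N - u n) < e) ->
  exists l, forall e : R, 0 < e -> exists N, forall n, (N <= n)%N ->
     rnorm (l - u n) < e.
Proof.
move=> H; have : cvg (u @ \oo).
  apply/cauchy_cvgP/cauchy_exP => e e0.
  have ee : e = (complex.Re e)%:C by rewrite RRe_real ?gtr0_real.
  have [|N HN] := H (complex.Re e); first by rewrite -ltcR -ee.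
  exists (u N); exists N => // n /= Nn.
  by rewrite -ball_normE /= rnormE ee ltcR HN.
move=> /cvg_ballP ul; exists (lim (u @ \oo)) => e e0.
have [|N _ HN] := ul e%:C; first by rewrite ltcR.
exists N => n Nn; have := HN n Nn.
by rewrite -ball_normE /= rnormE ltcR.
Qed.

(* [banach_fixed_point] does not apply: it is stated for normed modules over a
   [realType], and the scalars of [A] are [R[i]]. *)
Lemma contraction_fixpoint V (f : A -> A) (q : R) : closed V -> V 0 ->
  (forall x, V x -> V (f x)) -> 0 <= q < 1 ->
  (forall x y, rnorm (f x - f y) <= q * rnorm (x - y)) ->
  exists2 y, V y & f y = y.
Proof.
move=> Vcl V0 fV /andP[q0 q1] fq; pose u n := iter n f 0.
have uS n : rnorm (u n.+1 - u n) <= q ^+ n * rnorm (u 1%N - u 0%N).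
  elim: n => [|n IH]; first by rewrite mul1r.
  by rewrite exprS -mulrA; apply: le_trans (fq _ _) _; rewrite ler_wpM2l.
set C := rnorm (u 1%N - u 0%N) in uS.
have C0 : 0 <= C by exact: rnorm_ge0.
(* The geometric sum is kept exactly, with its factor [1 - q ^+ m], so that the induction on [m]
   closes. *)
have uD n m : rnorm (u n - u (n + m)%N) <= q ^+ n * (C / (1 - q)) * (1 - q ^+ m).
  elim: m => [|m IH]; first by rewrite addn0 !subrr rnorm0 mulr0.
  rewrite addnS -[_ - _](subrKA (u (n + m)%N)) (le_trans (rnormD _ _))//.
  have := uS (n + m)%N; rewrite rnormBC => S.
  apply: le_trans (lerD IH S) _.
  rewrite exprD [q ^+ m.+1]exprS le_eqVlt; apply/orP; left; apply/eqP; field; lra.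
have [|l Hl] := @rnorm_cauchy_cvg u.
  move=> e e0; have D0 : 0 <= C / (1 - q) by apply: divr_ge0 => //; lra.
  have [N _ HN] : \forall n \near \oo, geometric (C / (1 - q)) q n < e.
    by apply: cvgr_lt e0; apply: cvg_geometric; rewrite ger0_norm.
  exists N => n Nn; rewrite -(subnKC Nn); apply: le_lt_trans (uD _ _) _.
  apply: le_lt_trans (HN N (leqnn N)); rewrite /geometric /= [leRHS]mulrC.
  have := exprn_ge0 (n - N)%N q0; have := exprn_ge0 N q0 => ? ?.
  by rewrite ler_piMr ?(mulr_ge0 _ D0)// lerBlDr lerDl.
exists l.
  apply: closed_rnorm => // e e0; have [N HN] := Hl e e0.
  by exists (u N); [rewrite /u; elim: N {HN} => //= N; apply: fV|exact: HN].
apply/eqP; rewrite -subr_eq0; apply/eqP/rnorm_eq0/ler_addgt0Pr => e e0.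
have [|N HN] := Hl (e / 2); first by rewrite divr_gt0.
rewrite add0r -[_ - _](subrKA (u N.+1)) (le_trans (rnormD _ _))//.
have := fq l (u N); rewrite -/(u N.+1) => F.
have := HN _ (leqnn N); have := HN _ (leqnSn N).
rewrite [rnorm (l - u N.+1)]rnormBC => ? ?.
have := rnorm_ge0 (l - u N) => ?.
have : q * rnorm (l - u N) <= rnorm (l - u N) by rewrite ler_piMl// ltW.
lra.
Qed.

End CStarNorm.

(** * Resolvents of self-adjoint elements *)

Section Resolvent.
Context {R : realType} {A : cstarAlgType R}.
Implicit Types (a h x y z : A) (V : set A) (e s t : R).

Lemma cstarZi s a : cstar (('i * s%:C) *: a) = (- ('i * s%:C)) *: cstar a.
Proof.
rewrite cstarZ; congr (_ *: _).
by apply/eqP; rewrite eq_complex /=; apply/andP; split; apply/eqP; ring.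
Qed.

(** [A] may lack a unit, so [1 + i s h] is applied to [y]. In the C*-identity the terms of first
    order in [s] cancel because [h] is self-adjoint, and [1 + r^2 <= (1 + r^2 / 2)^2] for
    [r = s |h|]. *)
Lemma rnorm_one_plus_ih h s y : cstar h = h ->
  rnorm (y + ('i * s%:C) *: (h ** y)) <= (1 + (s * rnorm h) ^+ 2 / 2) * rnorm y.
Proof.
move=> hh; have C0 : 0 <= 1 + (s * rnorm h) ^+ 2 / 2.
  by have := sqr_ge0 (s * rnorm h) => ?; lra.
rewrite -(@ler_pXn2r _ 2)// ?nnegrE ?mulr_ge0 ?rnorm_ge0// -rnorm_cstarM.
have -> : cstar (y + ('i * s%:C) *: (h ** y)) ** (y + ('i * s%:C) *: (h ** y)) =
    cstar y ** y + (s ^+ 2)%:C *: (cstar (h ** y) ** (h ** y)).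
  rewrite cstarD cstarZi cstarM hh cmulDl !cmulDr !cmulZl !cmulZr scalerA.
  rewrite !cmulA addrACA -addrA; congr (_ + _).
  rewrite scaleNr addrA addNr add0r; congr (_ *: _).
  by apply/eqP; rewrite eq_complex /=; apply/andP; split; apply/eqP; ring.
rewrite (le_trans (rnormD _ _))// rnormZR !rnorm_cstarM.
have := rnormM h y; have := rnorm_ge0 h; have := rnorm_ge0 y.
have := rnorm_ge0 (h ** y).
move: (rnorm h) (rnorm y) (rnorm (h ** y)) => H Y Z Z0 Y0 H0 ZHY.
have : Z ^+ 2 <= (H * Y) ^+ 2 by rewrite ler_pXn2r// nnegrE mulr_ge0.
rewrite ger0_norm ?sqr_ge0// => /(ler_wpM2l (sqr_ge0 s)) ZH.
have := sqr_ge0 ((s * H) ^+ 2 / 2 * Y) => Q.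
apply: (@le_trans _ _ (Y ^+ 2 + s ^+ 2 * (H * Y) ^+ 2)); first by rewrite lerD2l.
rewrite -subr_ge0; apply: le_trans Q _; rewrite le_eqVlt; apply/orP; left.
by apply/eqP; field.
Qed.

(** With [z = (i t + h) y] one has [(1 + e t^2) y = (1 + i e t h) y - i e t z]. The bound on
    [1 + i e t h] exceeds 1 only by order [e^2], so dividing by [e] and letting [e] tend to 0 leaves
    [t^2 |y| <= |t| |z|]. *)
Lemma rnorm_shift h t y : cstar h = h ->
  `|t| * rnorm y <= rnorm (('i * t%:C) *: y + h ** y).
Proof.
move=> hh; set z := _ + _; have [->|t0] := eqVneq t 0.
  by rewrite normr0 mul0r rnorm_ge0.
have tp : 0 < `|t| by rewrite normr_gt0.
have key (e : R) : 0 < e ->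
    (1 + e * t ^+ 2) * rnorm y <=
    (1 + (e * t * rnorm h) ^+ 2 / 2) * rnorm y + e * `|t| * rnorm z.
  move=> e0; have -> : (1 + e * t ^+ 2) * rnorm y =
      rnorm ((1 + e * t ^+ 2)%:C *: y).
    by rewrite rnormZR ger0_norm// addr_ge0// mulr_ge0 ?sqr_ge0// ltW.
  have -> : (1 + e * t ^+ 2)%:C *: y =
      (y + ('i * (e * t)%:C) *: (h ** y)) - ('i * (e * t)%:C) *: z.
    rewrite /z scalerDr scalerA opprD addrACA subrr addr0.
    rewrite -[X in X - _]scale1r -scalerBl; congr (_ *: _).
    by apply/eqP; rewrite eq_complex /=; apply/andP; split; apply/eqP; ring.
  rewrite (le_trans (rnormB _ _))// lerD ?rnorm_one_plus_ih// rnormZi.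
  by rewrite normrM gtr0_norm.
rewrite -(ler_pM2l tp); apply/ler_addgt0Pr => d d0.
set D := (`|t| * rnorm h) ^+ 2 / 2 * rnorm y.
have D0 : 0 <= D by rewrite mulr_ge0 ?rnorm_ge0// divr_ge0// sqr_ge0.
(* This [e] makes the second-order term [e^2 D] at most [e d]. *)
pose e := d / (D + 1).
have D1 : 0 < D + 1 by lra.
have e0 : 0 < e by rewrite divr_gt0.
have eD : e * D <= d by rewrite /e mulrAC ler_pdivrMr// ler_wpM2l ?ltW//; lra.
have := key _ e0.
have -> : (e * t * rnorm h) ^+ 2 = e ^+ 2 * (`|t| * rnorm h) ^+ 2.
  by rewrite !exprMn real_normK ?num_real//; ring.
have -> : t ^+ 2 = `|t| ^+ 2 by rewrite real_normK ?num_real.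
move=> K; rewrite -(ler_pM2l e0) mulrDr; move: eD => /(ler_wpM2l (ltW e0)).
move: K; rewrite /D; nra.
Qed.

(** The same identity is read as the fixed-point equation [y = q^-1 ((1 + i e t h) y - i e t z)]
    with [q = 1 + e t^2], whose right-hand side is a contraction of [V] for small [e]. *)
Lemma shift_solve V h t z : linear_subspace V -> closed V ->
  (forall v, V v -> V (h ** v)) -> cstar h = h -> t != 0 -> V z ->
  exists2 y, V y & ('i * t%:C) *: y + h ** y = z.
Proof.
move=> [V0 VD VZ] Vcl hV hh t0 Vz.
have tp : 0 < t ^+ 2 by rewrite exprn_even_gt0.
pose H := (rnorm h) ^+ 2.
have H0 : 0 <= H by rewrite sqr_ge0.
(* This gives [e H <= 1], hence [(e t |h|)^2 / 2 <= e t^2 / 2], and the ratio [p] below is less than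
   1. *)
pose e := (H + 1)^-1.
have e0 : 0 < e by rewrite invr_gt0; lra.
pose g y := y + ('i * (e * t)%:C) *: (h ** y).
pose q := 1 + e * t ^+ 2.
have q0 : 0 < q by rewrite addr_gt0// mulr_gt0.
pose f y := (q^-1)%:C *: (g y - ('i * (e * t)%:C) *: z).
pose p := (1 + (e * t * rnorm h) ^+ 2 / 2) / q.
have [|||y Vy fy] := @contraction_fixpoint _ _ V f p Vcl V0.
- move=> y Vy; rewrite /f /g; apply: (VZ); apply: (VD).
    by apply: VD => //; apply: VZ; apply: hV.
  by rewrite -scaleN1r; do 2 apply: (VZ).
- apply/andP; split.
    by rewrite divr_ge0 ?(ltW q0)// addr_ge0// divr_ge0 ?sqr_ge0.
  rewrite ltr_pdivrMr// mul1r ltrD2l.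
  have -> : (e * t * rnorm h) ^+ 2 = (e * t ^+ 2) * (e * H) by rewrite /H; ring.
  have eH : e * H <= 1 by rewrite /e mulrC ler_pdivrMr ?mul1r; lra.
  have et : 0 < e * t ^+ 2 by rewrite mulr_gt0.
  have := ler_wpM2l (ltW et) eH; lra.
- move=> y y'.
  have -> : f y - f y' = (q^-1)%:C *: g (y - y').
    rewrite /f -scalerBr opprB subrKA; congr (_ *: _).
    by rewrite /g cmulBr scalerBr opprD addrACA.
  rewrite rnormZR gtr0_norm ?invr_gt0// /p [leRHS]mulrAC [leRHS]mulrC.
  by rewrite ler_wpM2l ?invr_ge0 ?(ltW q0)// rnorm_one_plus_ih.
exists y => //.
have : q%:C *: y = g y - ('i * (e * t)%:C) *: z.
  rewrite -{1}fy /f scalerA -rmorphM/= divff ?gt_eqF// rmorph1.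
  by rewrite scale1r.
rewrite /q rmorphD/= scalerDl scale1r /g -addrA => /addrI E.
(* Up to rearrangement, [E] is the wanted equation multiplied by [i e t]. *)
have k0 : 'i * (e * t)%:C != 0 :> R[i].
  have et0 : e * t != 0 by rewrite mulf_neq0// gt_eqF.
  apply: contra_neq et0 => /(congr1 (@complex.Im R)) /=.
  by rewrite mul0r mul1r add0r.
apply: (scalerI k0); apply/eqP; rewrite -subr_eq0; apply/eqP.
rewrite scalerDr scalerA -addrA -E -scalerDl.
have -> : 'i * (e * t)%:C * ('i * t%:C) + (e * t ^+ 2)%:C = 0 :> R[i].
  by apply/eqP; rewrite eq_complex /=; apply/andP; split; apply/eqP; ring.
by rewrite scale0r.
Qed.

(* [u] solves [(t^2 + h^2) u = h^2]; the operator [t^2 + h^2] is the product of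
   the shifts by [i t] and by [- i t]. *)
Lemma approximate_left_unit V x e : linear_subspace V -> closed V ->
  V (x ** cstar x) -> (forall v, V v -> V (x ** cstar x ** v)) -> 0 < e ->
  exists u, [/\ V u, forall a, rnorm (a - u ** a) <= rnorm a &
                rnorm (x - u ** x) <= e].
Proof.
set h := x ** cstar x => Vlin Vcl Vh hV e0.
have hh : cstar h = h by rewrite /h cstarM cstarK.
(* The estimates below end with [|x - u x|^4 <= |g|^2 <= |h g| <= 2 t |h|], and this [t] makes the
   last term at most [e^4]. *)
pose t := e ^+ 4 / (2 * rnorm h + 1).
have D0 : 0 < 2 * rnorm h + 1 by have := rnorm_ge0 h => ?; lra.
have tp : 0 < t by rewrite divr_gt0// exprn_gt0.
pose S s y := ('i * s%:C) *: y + h ** y.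
pose P y := S t (S (- t) y).
have SM s y a : S s y ** a = S s (y ** a) by rewrite /S cmulDl cmulZl cmulA.
have PM y a : P y ** a = P (y ** a) by rewrite /P !SM.
have SB s y z : S s (y - z) = S s y - S s z.
  by rewrite /S scalerBr cmulBr opprD addrACA.
have PB y z : P (y - z) = P y - P z by rewrite /P !SB.
have PE y : P y = (t ^+ 2)%:C *: y + h ** h ** y.
  rewrite /P /S scalerDr cmulDr cmulZr scalerA addrA cmulA.
  rewrite -(addrA (_ *: y)) -scalerDl.
  have -> : 'i * t%:C + 'i * (- t)%:C = 0 :> R[i].
    by apply/eqP; rewrite eq_complex /=; apply/andP; split; apply/eqP; ring.
  rewrite scale0r addr0; congr (_ *: _ + _).
  by apply/eqP; rewrite eq_complex /=; apply/andP; split; apply/eqP; ring.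
have Sh s y : S s (h ** y) = h ** S s y by rewrite /S cmulDr cmulZr.
have Ple y : t ^+ 2 * rnorm y <= rnorm (P y).
  have := rnorm_shift h t (S (- t) y) hh; have := rnorm_shift h (- t) y hh.
  rewrite normrN gtr0_norm// -/(S _ _) -/(S _ _) -/(P y) => H1 H2.
  by apply: le_trans H2; rewrite expr2 -mulrA ler_wpM2l// ltW.
have Pinj y z : P y = P z -> y = z.
  move=> yz; apply/eqP; rewrite -subr_eq0; apply/eqP/rnorm_eq0.
  have := Ple (y - z); rewrite PB yz subrr rnorm0.
  by rewrite pmulr_rle0// exprn_gt0.
have t0 : t != 0 by rewrite gt_eqF.
have [w Vw Sw] := shift_solve V h t (h ** h) Vlin Vcl hV hh t0 (hV h Vh).
have Nt0 : - t != 0 by rewrite oppr_eq0.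
have [u Vu Su] := shift_solve V h (- t) w Vlin Vcl hV hh Nt0 Vw.
have Pu : P u = h ** h by rewrite /P /S Su Sw.
(* Thus [1 - u] acts as [t^2 (t^2 + h^2)^-1], and the lower bound [Ple] makes it contractive. *)
have Pa a : P (a - u ** a) = (t ^+ 2)%:C *: a.
  by rewrite PB -PM Pu PE addrK.
have ua a : rnorm (a - u ** a) <= rnorm a.
  have := Ple (a - u ** a).
  by rewrite Pa rnormZR ger0_norm ?sqr_ge0// ler_pM2l// exprn_gt0.
exists u; split=> //.
(* The injective map [P] sends both sides to [h^3]. *)
have hu : h ** u = u ** h.
  by apply: Pinj; rewrite -(PM u h) Pu /P !Sh -/(P u) Pu cmulA.
set g := h - u ** h.
have hg : rnorm (h ** g) <= 2 * t * rnorm h.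
  (* Since [S t r = P g = t^2 h], the shift bound gives [|r| <= t |h|]; the other term has norm
     [t |g| <= t |h|]. *)
  set r := S (- t) g; have -> : h ** g = r - ('i * (- t)%:C) *: g.
    by rewrite /r /S addrAC subrr add0r.
  rewrite (le_trans (rnormB _ _))// rnormZi normrN gtr0_norm//.
  have := rnorm_shift h t r hh; rewrite -/(S t r) -/(P g) Pa rnormZR.
  rewrite (gtr0_norm tp) ger0_norm ?sqr_ge0// expr2 -(mulrA t) ler_pM2l// => rt.
  have := ler_wpM2l (ltW tp) (ua h); rewrite -/g; lra.
have gh : h ** g = g ** h by rewrite /g cmulBl cmulBr cmulA hu.
(* Here [g g^* = (1 - u) h g^*], and [1 - u] is contractive. The same device bounds [|x - u x|^2] by
   [|g|] next. *)
have g2 : rnorm g ^+ 2 <= rnorm (h ** g).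
  have -> : rnorm (h ** g) = rnorm (h ** cstar g).
    by rewrite gh -rnorm_cstar cstarM hh.
  rewrite -rnormM_cstar {1}/g cmulBl -cmulA; exact: ua.
have v2 : rnorm (x - u ** x) ^+ 2 <= rnorm g.
  have -> : rnorm g = rnorm (x ** cstar (x - u ** x)).
    by rewrite -[RHS]rnorm_cstar cstarM cstarK cmulBl -cmulA.
  rewrite -rnormM_cstar {1}cmulBl -cmulA; exact: ua.
rewrite -(@ler_pXn2r _ 4)// ?nnegrE ?rnorm_ge0 ?(ltW e0)//.
have -> : rnorm (x - u ** x) ^+ 4 = (rnorm (x - u ** x) ^+ 2) ^+ 2.
  by rewrite -exprM.
have v4 : (rnorm (x - u ** x) ^+ 2) ^+ 2 <= rnorm g ^+ 2.
  by rewrite ler_pXn2r ?nnegrE ?sqr_ge0 ?rnorm_ge0.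
apply: (le_trans v4); apply: (le_trans g2); apply: (le_trans hg).
have -> : e ^+ 4 = t * (2 * rnorm h + 1) by rewrite /t mulfVK// gt_eqF.
by rewrite [2 * t]mulrC -mulrA ler_wpM2l ?(ltW tp)// lerDl.
Qed.

End Resolvent.

(** * Ideals of a subalgebra and the right ideals they generate *)

Section Ideals.
Context {R : realType} {A : cstarAlgType R}.
Implicit Types (a b c n u x y : A) (B L V : set A) (e : R) (k : R[i]).

Lemma linear_subspaceB V a b : linear_subspace V -> V a -> V b -> V (a - b).
Proof.
by case=> _ VD VZ Va Vb; apply: VD => //; rewrite -scaleN1r; apply: VZ.
Qed.

Lemma subcmulD u a b :
  a + b - u ** (a + b) = (a - u ** a) + (b - u ** b).
Proof. by rewrite cmulDr opprD addrACA. Qed.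

Section IdealOfSubalgebra.
Context {B J : set A} (hB : cstar_subalgebra B) (hJ : cstar_ideal B J).

(** Only [x x^*] has to lie in [J]: [x] may be outside [B], as happens for a normalizer times an
    element of [J]. *)
Lemma ideal_left_unit x e : J (x ** cstar x) -> 0 < e ->
  exists u, [/\ J u, forall a, rnorm (a - u ** a) <= rnorm a &
                rnorm (x - u ** x) <= e].
Proof.
case: hJ => JB Jlin Jcl JM Jx; apply: approximate_left_unit => // v Jv.
by have [] := JM v _ Jv (JB _ Jx).
Qed.

Lemma ideal_memM_cstar x : B x -> J (x ** cstar x) -> J x.
Proof.
move=> Bx Jx; have [JB Jlin Jcl JM] := hJ.
apply: closed_rnorm => // e e0.
have [||u [Ju _ ux]] := ideal_left_unit x (e / 2) => //.
  by rewrite divr_gt0.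
exists (u ** x); first by have [] := JM u x Ju Bx.
by apply: le_lt_trans ux _; lra.
Qed.

Lemma ideal_cstar x : J x -> J (cstar x).
Proof.
move=> Jx; have [JB _ _ JM] := hJ; have [_ _ _ BS] := hB.
apply: ideal_memM_cstar; first exact/BS/JB.
by rewrite cstarK; have [] := JM x (cstar x) Jx (BS _ (JB _ Jx)).
Qed.

(* The closed right ideal generated by [J], described so that its elements can
   be multiplied back into [J]; the contractivity of [1 - u] makes it closed. *)
Definition right_hull : set A := [set a | forall e : R, 0 < e ->
  exists u, [/\ J u, forall c, rnorm (c - u ** c) <= rnorm c &
                rnorm (a - u ** a) <= e]].

Lemma right_hull_memM_cstar x : J (x ** cstar x) -> right_hull x.
Proof. by move=> Jx e; apply: ideal_left_unit. Qed.

Lemma sub_right_hull : J `<=` right_hull.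
Proof.
move=> x Jx; apply: right_hull_memM_cstar; have [JB _ _ JM] := hJ.
by have [] := JM x (cstar x) Jx (JB _ (ideal_cstar _ Jx)).
Qed.

Lemma right_hull_closed : closed right_hull.
Proof.
move=> a /closure_rnorm Ka e e0.
have e3 : 0 < e / 3 by rewrite divr_gt0.
have [b Kb ab] := Ka _ e3; have [u [Ju u1 ub]] := Kb _ e3.
exists u; split=> //.
have -> : a - u ** a = (a - b - u ** (a - b)) + (b - u ** b).
  by rewrite -subcmulD subrK.
rewrite (le_trans (rnormD _ _))//; have := u1 (a - b); lra.
Qed.

Lemma right_hullM a c : right_hull a -> right_hull (a ** c).
Proof.
move=> Ka e e0; have D0 : 0 < rnorm c + 1 by have := rnorm_ge0 c => ?; lra.
have [|u [Ju u1 ua]] := Ka (e / (rnorm c + 1)); first by rewrite divr_gt0.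
exists u; split=> //; rewrite cmulA -cmulBl (le_trans (rnormM _ _))//.
have := ler_wpM2r (rnorm_ge0 c) ua; move/le_trans; apply.
by rewrite mulrAC ler_pdivrMr// ler_wpM2l ?(ltW e0)// lerDl.
Qed.

Lemma right_hullZ k a : right_hull a -> right_hull (k *: a).
Proof.
move=> Ka e e0; set C := complex.Re `|k|.
have C0 : 0 <= C by rewrite -lecR RRe_real ?normr_real ?normr_ge0.
have D0 : 0 < C + 1 by lra.
have [|u [Ju u1 ua]] := Ka (e / (C + 1)); first by rewrite divr_gt0.
exists u; split=> //; rewrite cmulZr -scalerBr rnormZ -/C.
have := ler_wpM2l C0 ua; move/le_trans; apply.
by rewrite mulrC mulrAC ler_pdivrMr// ler_wpM2l ?(ltW e0)// lerDl.
Qed.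

(* With [1 - u] and [1 - v] almost annihilating [a] and [b], the product
   [(1 - w) (1 - u)] does so for [a + b] as soon as [1 - w] almost annihilates
   the element [(1 - u) v] of [J]. *)
Lemma right_hullD a b : right_hull a -> right_hull b -> right_hull (a + b).
Proof.
move=> Ka Kb e e0; have [JB Jlin Jcl JM] := hJ.
have JJ x y : J x -> J y -> J (x ** y).
  by move=> Jx Jy; have [] := JM x y Jx (JB _ Jy).
have e3 : 0 < e / 3 by rewrite divr_gt0.
have [u [Ju u1 ua]] := Ka _ e3; have [v [Jv v1 vb]] := Kb _ e3.
have Jj : J (v - u ** v) by apply: linear_subspaceB => //; apply: JJ.
have [w [Jw w1 wb]] := right_hullM _ b (sub_right_hull _ Jj) _ e3.
exists (w + u - w ** u).
have comp c : c - (w + u - w ** u) ** c = (c - u ** c) - w ** (c - u ** c).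
  rewrite cmulBl cmulDl cmulBr cmulA !opprB opprD -addrA; congr (_ + _).
  by rewrite addrA [RHS]addrC.
split=> [|c|].
- apply: linear_subspaceB => //; last exact: JJ.
  by case: Jlin => _ JD _; apply: JD.
- by rewrite comp; apply: le_trans (w1 _) (u1 _).
(* Splitting [b] as [(1 - v) b + v b] cuts [(1 - w) (1 - u) (a + b)] into three terms of norm at
   most [e / 3] each. *)
have -> : a + b - (w + u - w ** u) ** (a + b) =
   ((a - u ** a) - w ** (a - u ** a)) +
   (((b - v ** b) - u ** (b - v ** b) -
       w ** ((b - v ** b) - u ** (b - v ** b))) +
    ((v - u ** v) ** b - w ** ((v - u ** v) ** b))).
  rewrite comp (subcmulD u a) (subcmulD w (a - u ** a)); congr (_ + _).
  have -> : b - u ** b = (b - v ** b - u ** (b - v ** b)) + (v - u ** v) ** b.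
    by rewrite cmulBl -cmulA -subcmulD subrK.
  exact: subcmulD.
have := w1 (a - u ** a); have := w1 ((b - v ** b) - u ** (b - v ** b)).
have := u1 (b - v ** b) => ? ? ?.
apply: le_trans (rnormD _ _) _; have := rnormD
  ((b - v ** b) - u ** (b - v ** b) -
       w ** ((b - v ** b) - u ** (b - v ** b)))
  ((v - u ** v) ** b - w ** ((v - u ** v) ** b)); lra.
Qed.

Lemma right_hull_linear : linear_subspace right_hull.
Proof.
split; [|exact: right_hullD|exact: right_hullZ].
by apply: sub_right_hull; case: hJ => _ [].
Qed.

Lemma right_hull_sub b : B b -> right_hull b -> J b.
Proof.
move=> Bb Kb; have [JB Jlin Jcl JM] := hJ; apply: closed_rnorm => // e e0.
have [|u [Ju _ ub]] := Kb (e / 2); first by rewrite divr_gt0.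
exists (u ** b); first by have [] := JM u b Ju Bb.
by apply: le_lt_trans ub _; lra.
Qed.

(** [n a] is a limit of elements [n u a] with [u] in [J], and [n u] is in the hull because
    [n u u^* n^*] lies in [J]. *)
Lemma normalizer_right_hull n : (forall j, J j -> J (n ** j ** cstar n)) ->
  forall a, right_hull a -> right_hull (n ** a).
Proof.
move=> nJ a Ka; have [JB Jlin Jcl JM] := hJ.
apply: closed_rnorm; first exact: right_hull_closed.
move=> e e0; have D0 : 0 < rnorm n + 1 by have := rnorm_ge0 n => ?; lra.
have [|u [Ju _ ua]] := Ka (e / 2 / (rnorm n + 1)).
  by rewrite !divr_gt0.
exists (n ** u ** a).
  apply/right_hullM/right_hull_memM_cstar.
  rewrite cstarM cmulA -(cmulA n); apply: nJ.
  by have [] := JM u (cstar u) Ju (JB _ (ideal_cstar _ Ju)).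
rewrite -cmulA -cmulBr; apply: le_lt_trans (rnormM _ _) _.
apply: le_lt_trans (ler_wpM2l (rnorm_ge0 n) ua) _.
rewrite mulrC mulrAC ltr_pdivrMr//.
by have := rnorm_ge0 n => ?; nra.
Qed.

Lemma right_hull_ideal : regular_inclusion B ->
  (forall n, normalizer (@cmul R A) (@cstar R A) B n ->
             normalizer (@cmul R A) (@cstar R A) J n) ->
  cstar_ideal setT right_hull.
Proof.
move=> Breg BJ; have [_ KD KZ] := right_hull_linear.
(* [M] is shown to be a C*-subalgebra containing the normalizers, hence all of [A]; treating [n] and
   [cstar n] together makes it closed under adjoints. *)
pose M : set A := [set n | forall a, right_hull a ->
  right_hull (n ** a) /\ right_hull (cstar n ** a)].
have K0 : right_hull 0 by case: right_hull_linear.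
have MT : M = setT.
  apply/seteqP; split=> // n _; have : [set: A] n by [].
  rewrite -Breg; apply: smallest_sub.
    split=> [|m|m p|m].
    - split=> [a _|m p|k m].
      + by rewrite -(cstarK 0) cstarK -(scale0r (0 : A)) cstarZ !cmulZl
          conjC0 !scale0r.
      + move=> Mm Mp a Ka; have [? ?] := Mm a Ka; have [? ?] := Mp a Ka.
        by rewrite cstarD !cmulDl; split; apply: KD.
      + move=> Mm a Ka; have [? ?] := Mm a Ka.
        by rewrite cstarZ !cmulZl; split; apply: KZ.
    - move=> /closure_rnorm Mm a Ka.
      (* [f] will be the identity or the conjugate-linear [cstar], hence the conditions on
         differences and norms alone. *)
      have H (f : A -> A) : (forall x y, f (x - y) = f x - f y) ->
          (forall x, rnorm (f x) = rnorm x) ->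
          (forall p, M p -> right_hull (f p ** a)) -> right_hull (f m ** a).
        move=> fB fn fK; apply: closed_rnorm; first exact: right_hull_closed.
        move=> e e0; have D0 : 0 < rnorm a + 1.
          by have := rnorm_ge0 a => ?; lra.
        have [|p Mp mp] := Mm (e / (rnorm a + 1)); first by rewrite divr_gt0.
        exists (f p ** a); first exact: fK.
        rewrite -cmulBl -fB; apply: le_lt_trans (rnormM _ _) _; rewrite fn.
        apply: le_lt_trans (ler_wpM2r (rnorm_ge0 a) (ltW mp)) _.
        rewrite mulrAC ltr_pdivrMr//; nra.
      split; last by apply: H => [x y|x|p Mp]; [exact: cstarB|exact: rnorm_cstar|
        have [] := Mp a Ka].
      by apply: (H id) => // p Mp; have [] := Mp a Ka.
    - move=> Mm Mp a Ka; rewrite cstarM -!cmulA; split.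
        by have [pa _] := Mp a Ka; have [] := Mm _ pa.
      by have [_ ma] := Mm a Ka; have [] := Mp _ ma.
    - by move=> Mm a Ka; rewrite cstarK; have [] := Mm a Ka.
  move=> {}n /BJ nJ a Ka; split; apply: normalizer_right_hull => // j Jj.
    by have [] := nJ j Jj.
  by rewrite cstarK; have [] := nJ j Jj.
split=> //; first exact: right_hull_closed.
move=> a b Ka _; split; first exact: right_hullM.
by have : M b by [rewrite MT]; move=> /(_ a Ka)[].
Qed.

End IdealOfSubalgebra.

(** * Normalizers, local units and multipliers *)

(** Full normalization concerns normalizers among multipliers, regularity those in [A]; injectivity
    of [embed] links the two. *)
Lemma normalizer_embed V n :
  normalizer (@mmul R A) (@mstar R A) (@embed R A @` V) (embed n) <->
  normalizer (@cmul R A) (@cstar R A) V n.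
Proof.
split=> H b.
  move=> Vb; have [|[c Vc Ec] [d Vd Ed]] := H (embed b); first by exists b.
  split.
    suff <- : c = n ** b ** cstar n by [].
    by apply: embed_inj; rewrite Ec !embedM embed_star.
  suff <- : d = cstar n ** b ** n by [].
  by apply: embed_inj; rewrite Ed !embedM embed_star.
case=> c Vc <-; have [? ?] := H c Vc; rewrite -embed_star -!embedM.
by split; [exists (n ** c ** cstar n)|exists (cstar n ** c ** n)].
Qed.

Lemma nondegenerate_local_unit B a e : nondegenerate_inclusion B -> 0 < e ->
  exists u, [/\ B u, rnorm (a - u ** a) < e & rnorm (a - a ** u) < e].
Proof.
move=> [I [le [w [[[[i0 _] lexx _ dir] _ Hw] Bw]]]] e0.
have tailsE (f : I -> A) : f i @[i --> tails le] --> a ->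
    exists i, forall j, le i j -> rnorm (a - f j) < e.
  move=> fa; have /fa[i _ Hi] : nbhs a (ball a e%:C).
    by apply: nbhsx_ballx; rewrite ltcR.
  exists i => j ij; have := Hi j ij.
  by rewrite /= -ball_normE /= rnormE ltcR.
have [/tailsE[i Hi] /tailsE[j Hj]] := Hw a.
have [k [ik jk]] := dir i j.
by exists (w k); split; [exact: Bw|exact: Hi|exact: Hj].
Qed.

Lemma rnorm_bounded_operator (f : A -> A) : bounded_operator f ->
  exists2 C : R, 0 < C & forall a, rnorm (f a) <= C * rnorm a.
Proof.
case=> _ _ [k Hk]; exists (`|k| + 1) => [|a].
  by rewrite ltr_wpDl.
have : rnorm (f a) <= k * rnorm a.
  by rewrite -lecR -rnormE rmorphM/= -rnormE.
move/le_trans; apply; rewrite ler_wpM2r ?rnorm_ge0//.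
by rewrite (le_trans (ler_norm k))// lerDl.
Qed.

Lemma bounded_operatorB (f : A -> A) : bounded_operator f ->
  forall a b, f (a - b) = f a - f b.
Proof. by case=> fD fZ _ a b; rewrite fD -scaleN1r fZ scaleN1r. Qed.

(** The elements [m (u a) = (m u) a] and [(a u) m = a (u m)] lie in [L], and they approximate [m a]
    and [a m] for local units [u], since multipliers act boundedly. *)
Lemma ideal_multiplier B L (m : multiplier A) a : nondegenerate_inclusion B ->
  cstar_ideal setT L -> L a -> L (lmult m a) /\ L (rmult m a).
Proof.
move=> Bnd [_ Llin Lcl LM] La.
have H (f : A -> A) : bounded_operator f ->
    (forall u, L (f (u ** a)) \/ L (f (a ** u))) -> L (f a).
  move=> fb fL; have [C C0 fC] := rnorm_bounded_operator f fb.
  apply: closed_rnorm => // e e0.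
  have [|u [_ ua au]] := nondegenerate_local_unit B a (e / C) Bnd.
    by rewrite divr_gt0.
  have E b : rnorm (a - b) < e / C -> rnorm (f a - f b) < e.
    move=> ab; rewrite -bounded_operatorB//; apply: le_lt_trans (fC _) _.
    by rewrite mulrC -ltr_pdivlMr.
  by have [Lu|Lu] := fL u; [exists (f (u ** a))|exists (f (a ** u))] => //;
    apply: E.
split; apply: H.
- exact: lmult_bounded.
- by move=> u; left; rewrite lmultM; have [] := LM a (lmult m u) La.
- exact: rmult_bounded.
by move=> u; right; rewrite rmultM; have [] := LM a (rmult m u) La.
Qed.

(** For [j] in [B] and [L], [m j m^*] is the image of an element of [B] because [m] normalizes [B],
    and of an element of [L] because multipliers preserve [L]. Injectivity of [embed] identifies
    these elements. *)
Lemma capideal_fully_normalized B L : nondegenerate_inclusion B ->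
  cstar_ideal setT L -> fully_normalized B (B `&` L).
Proof.
move=> Bnd hL m mB.
have mL (p : multiplier A) j : L j ->
    exists2 c, L c & mmul (mmul p (embed j)) (mstar p) = embed c.
  move=> Lj; have [Lpj _] := ideal_multiplier B L p j Bnd hL Lj.
  exists (rmult (mstar p) (lmult p j)).
    by have [] := ideal_multiplier B L (mstar p) (lmult p j) Bnd hL Lpj.
  rewrite mmul_embed; apply: multiplier_ext => b.
    exact/esym/(rlmult (mstar p)).
  exact: (rmultM (mstar p)).
move=> _ [j [Bj Lj] <-]; have [|[c Bc Ec] [d Bd Ed]] := mB (embed j).
  by exists j.
split.
  exists c => //; split=> //; have [c' Lc' Ec'] := mL m j Lj.
  suff -> : c = c' by [].
  by apply: embed_inj; rewrite Ec Ec'.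
exists d => //; split=> //; have [d' Ld' Ed'] := mL (mstar m) j Lj.
suff -> : d = d' by [].
by apply: embed_inj; rewrite Ed -Ed' mstarK.
Qed.

End Ideals.

(** * From the right hull to minimality, and from essentiality back to simplicity *)

Theorem proposition6p10 (R : realType) (A : cstarAlgType R) (B : set A) :
  cstar_subalgebra B -> nondegenerate_inclusion B -> regular_inclusion B ->
  (cstar_simple A <-> essential_inclusion B /\ minimal_inclusion B).
Proof.
move=> hB Bnd Breg; split=> [simpleA|[ess mini] L hL].
  split=> [L hL LT _|J hJ nJ]; first by have [] := simpleA L hL.
  have BJ n : normalizer (@cmul R A) (@cstar R A) B n ->
      normalizer (@cmul R A) (@cstar R A) J n.
    by move=> /normalizer_embed/nJ/normalizer_embed.
  have [K0|KT] := simpleA _ (right_hull_ideal hB hJ Breg BJ).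
    left; apply/seteqP; split=> [x /(sub_right_hull hB hJ)|x ->].
      by rewrite K0.
    by case: hJ => _ [].
  right; apply/seteqP; split=> [|b Bb]; first by case: hJ.
  by apply: (right_hull_sub hJ) => //; rewrite KT.
(* Essentiality speaks of proper ideals, so the case of the whole algebra is set apart. *)
have [LT|LT] := pselect (L = setT); first by right.
have hBL : cstar_ideal B (B `&` L).
  have [[B0 BD BZ] Bcl BM _] := hB; have [_ [L0 LD LZ] Lcl LM] := hL.
  split; [by move=> x []|split=> //| exact: closedI |].
  - by move=> a b [? ?] [? ?]; split; [exact: BD|exact: LD].
  - by move=> k a [? ?]; split; [exact: BZ|exact: LZ].
  move=> a b [Ba La] Bb; have [? ?] := LM a b La I.
  by split; split=> //; apply: BM.
have [J0|JB] := mini _ hBL (capideal_fully_normalized B L Bnd hL).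
  by left; apply: ess.
(* Now [B] lies in [L], so local units [u] from [B] approximate [a] by elements [u a] of [L]. *)
right; apply/seteqP; split=> // a _; have [_ _ Lcl LM] := hL.
apply: closed_rnorm => // e e0.
have [u [Bu ua _]] := nondegenerate_local_unit B a e Bnd e0.
exists (u ** a) => //; have [_ Lu] : (B `&` L) u by rewrite JB.
by have [] := LM u a Lu I.
Qed.
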